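(* For a finite group $G$ with $|G|\ge2$, a probability measure $\mu$ on $G$ such that $P_\mu(x,y)=\mu(x^{-1}\cdot y)$ ($x,y\in G$) is irreducible and aperiodic, and $\alpha\in[0,1)$, let $t^{(\alpha)}_{\mathrm{mix}}(\varepsilon)=t^{(\alpha,G,\mu)}_{\mathrm{mix}}(\varepsilon)$ denote the $\varepsilon$-mixing time of the SRRW on $G$ with step distribution $\mu$ and reinforcement parameter $\alpha$. (i) If $G$ is a finite group with $|G|\ge2$, $\mu$ is a probability measure on $G$ such that $P_\mu$ is irreducible and aperiodic, $\alpha\in[0,1)$, and $\mu$ is a class function, then for any $\varepsilon\in(0,1)$, $$t^{(\alpha)}_{\mathrm{mix}}(\varepsilon)\le\frac1{1-\alpha}\max\left\{8\,t^{(0)}_{\mathrm{mix}}\left(\frac\varepsilon2\right),\ 18\log\left(\frac4\varepsilon\right)\right\}+1.$$ (ii) Assume that for each $n\ge1$, $\mu_n$ is a probability measure on a finite group $G_n$ ($|G_n|\ge2$) such that $P_{\mu_n}$ is irreducible and aperiodic and $\mu_n$ is a class function. If for any $\varepsilon\in(0,1)$ we have $t^{(0,G_n,\mu_n)}_{\mathrm{mix}}(\varepsilon/2)\to\infty$ as $n\to\infty$, then for any $\alpha\in[0,1)$ and any $\varepsilon\in(0,1)$, $$\limsup_{n\to\infty}\frac{t^{(\alpha,G_n,\mu_n)}_{\mathrm{mix}}(\varepsilon)}{t^{(0,G_n,\mu_n)}_{\mathrm{mix}}(\varepsilon/2)}\le\frac{1+\alpha}{1-\alpha}.$$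
   Context: SRRW: Let $(G,\cdot)$ be a discrete group with $|G|\ge2$ and identity $e_G$, $\mu$ a probability measure on $G$, and $\alpha\in[0,1)$. Let $(\xi_n)_{n\ge2}$ be i.i.d. Bernoulli random variables with $\mathbb{P}(\xi_n=1)=\alpha$, and let $(u_n)_{n\ge2}$ be independent with $u_n$ uniform on $\{1,\dots,n-1\}$; these two sequences and all fresh samples from $\mu$ below are independent. Set $S_0=e_G$; sample $X_1$ from $\mu$ and set $S_1=X_1$. For $n>1$: if $\xi_n=1$ set $X_n=X_{u_n}$; if $\xi_n=0$ sample $X_n$ afresh from $\mu$; put $S_n=S_{n-1}\cdot X_n$. The process $(S_n)$ is the SRRW on $G$ (started at $e_G$) with step distribution $\mu$ and reinforcement parameter $\alpha$. (For $\alpha=0$ it is the classical random walk with i.i.d. $\mu$-distributed steps.) Mixing time: with $U$ the uniform measure on the finite group $G$ and $\|\nu_1-\nu_2\|_{\mathrm{TV}}=\frac12\sum_{g\in G}|\nu_1(g)-\nu_2(g)|$, $$t^{(\alpha)}_{\mathrm{mix}}(\varepsilon)=\inf\{n\ge1:\ \|\mathbb{P}(S_m=\cdot)-U\|_{\mathrm{TV}}\le\varepsilon\ \text{ for all } m\ge n\}.$$ $\mu$ is a class function if $\mu(g^{-1}\cdot x\cdot g)=\mu(x)$ for all $x,g\in G$. *)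

(* Defs.v *)
From HB Require Import structures.
From mathcomp Require Import all_boot all_order all_algebra all_fingroup.
From mathcomp Require Import finmap.
From mathcomp Require Import all_classical all_reals all_analysis.

Set Implicit Arguments.
Unset Strict Implicit.
Unset Printing Implicit Defensive.

Import Order.TTheory GRing.Theory Num.Theory.
Import numFieldNormedType.Exports.

Local Open Scope classical_set_scope.
Local Open Scope ring_scope.

(* Probability measures on a finite type are given by their mass functions. *)
Definition is_pmf (R : realType) (V : finType) (mu : V -> R) : Prop :=
  (forall x, 0 <= mu x) /\ \sum_(x : V) mu x = 1.

Definition tv_dist (R : realType) (V : finType) (nu1 nu2 : V -> R) : R :=
  2^-1 * \sum_(g : V) `|nu1 g - nu2 g|.

Definition unif (R : realType) (V : finType) : V -> R :=
  fun _ => #|V|%:R^-1.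

Section MarkovKernel.
Context (R : realType) (V : finType).
Implicit Type P : V -> V -> R.

Fixpoint kernel_iter P (n : nat) (x y : V) : R :=
  if n is m.+1 then \sum_(z : V) P x z * kernel_iter P m z y
  else (x == y)%:R.

Definition irreducible_kernel P : Prop :=
  forall x y, exists n, 0 < kernel_iter P n x y.

(* gcd {n >= 1 | P^n(x,x) > 0} = 1 for every x: the only common divisor of
   this set is 1 (in particular the set is not empty). *)
Definition aperiodic_kernel P : Prop :=
  forall x (d : nat),
    (forall n, (1 <= n)%N -> 0 < kernel_iter P n x x -> (d %| n)%N) -> d = 1%N.

End MarkovKernel.

Definition walk_kernel (R : realType) (gT : finGroupType) (mu : gT -> R)
  : gT -> gT -> R := fun x y => mu (x^-1 * y)%g.

Definition class_pmf (R : realType) (gT : finGroupType) (mu : gT -> R) : Prop :=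
  forall x g : gT, mu (g^-1 * x * g)%g = mu x.

(* sigma(X) for a variable X with values in a discrete space *)
Definition rv_events (T V : Type) (X : T -> V) : set (set T) :=
  [set X @^-1` A | A in [set: set V]].

(* Mutual independence of the classes of events F i, i in D *)
Definition mutually_independent (R : realType) (d : measure_display)
    (T : measurableType d) (P : probability T R) (I : choiceType)
    (D : set I) (F : I -> set (set T)) : Prop :=
  forall (J : {fset I}) (E : I -> set T),
    [set` J] `<=` D -> (forall i, i \in J -> F i (E i)) ->
    P (\bigcap_(i in [set` J]) E i) = (\prod_(i <- J) P (E i))%E.

(* The index type nat + nat + nat tags the three sequences xi_n, u_n (n >= 2)
   and Z_n (n >= 1), so that a single independence statement covers them all. *)
Definition source_index : set (nat + nat + nat)%type :=
  [set i | match i with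
           | inl (inl n) => (2 <= n)%N
           | inl (inr n) => (2 <= n)%N
           | inr n => (1 <= n)%N
           end].

Definition source_events (T V : Type) (xi : nat -> T -> bool)
    (u : nat -> T -> nat) (Z : nat -> T -> V) (i : (nat + nat + nat)%type)
  : set (set T) :=
  match i with
  | inl (inl n) => rv_events (xi n)
  | inl (inr n) => rv_events (u n)
  | inr n => rv_events (Z n)
  end.

(* A realization, on some probability space, of the step-reinforced random walk
   S started at the identity, with step distribution mu and reinforcement
   parameter alpha.  Z n is the fresh sample from mu available at time n; it is
   used as the n-th step unless an earlier step is repeated.  The values of
   xi 0, xi 1, u 0, u 1, Z 0 and X 0 are irrelevant. *)
Record SRRW (R : realType) (gT : finGroupType) (mu : gT -> R) (alpha : R) :=
  MkSRRW {
  srrw_disp : measure_display ;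
  srrw_space : measurableType srrw_disp ;
  srrw_prob : probability srrw_space R ;
  srrw_xi : nat -> srrw_space -> bool ;
  srrw_u : nat -> srrw_space -> nat ;
  srrw_Z : nat -> srrw_space -> gT ;
  srrw_X : nat -> srrw_space -> gT ;
  srrw_S : nat -> srrw_space -> gT ;
  srrw_meas : forall i, source_index i ->
    source_events srrw_xi srrw_u srrw_Z i `<=` measurable ;
  srrw_xi_law : forall n, (2 <= n)%N ->
    srrw_prob (srrw_xi n @^-1` [set true]) = alpha%:E ;
  srrw_u_range : forall n w, (2 <= n)%N -> (1 <= srrw_u n w <= n.-1)%N ;
  srrw_u_law : forall n k, (2 <= n)%N -> (1 <= k <= n.-1)%N ->
    srrw_prob (srrw_u n @^-1` [set k]) = (n.-1%:R^-1)%:E ;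
  srrw_Z_law : forall n g, (1 <= n)%N ->
    srrw_prob (srrw_Z n @^-1` [set g]) = (mu g)%:E ;
  srrw_indep : mutually_independent srrw_prob source_index
    (source_events srrw_xi srrw_u srrw_Z) ;
  srrw_X1 : forall w, srrw_X 1%N w = srrw_Z 1%N w ;
  srrw_Xn : forall n w, (2 <= n)%N ->
    srrw_X n w = if srrw_xi n w then srrw_X (srrw_u n w) w else srrw_Z n w ;
  srrw_S0 : forall w, srrw_S 0%N w = 1%g ;
  srrw_Sn : forall n w, srrw_S n.+1 w = (srrw_S n w * srrw_X n.+1 w)%g
}.

Arguments srrw_prob {R gT mu alpha} W : rename.
Arguments srrw_xi {R gT mu alpha} W n w : rename.
Arguments srrw_u {R gT mu alpha} W n w : rename.
Arguments srrw_Z {R gT mu alpha} W n w : rename.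
Arguments srrw_X {R gT mu alpha} W n w : rename.
Arguments srrw_S {R gT mu alpha} W n w : rename.

Definition srrw_law (R : realType) (gT : finGroupType) (mu : gT -> R)
    (alpha : R) (W : SRRW mu alpha) (n : nat) : gT -> R :=
  fun g => fine (srrw_prob W (srrw_S W n @^-1` [set g])).

(* Extended-real valued, with inf of the empty set equal to +oo.  It depends on
   W only through the laws of S_n, hence only on gT, mu, alpha and eps. *)
Definition tmix (R : realType) (gT : finGroupType) (mu : gT -> R) (alpha : R)
    (W : SRRW mu alpha) (eps : R) : \bar R :=
  ereal_inf [set n%:R%:E | n in
    [set n : nat | (1 <= n)%N /\
       forall m, (n <= m)%N ->
         tv_dist (srrw_law W m) (@unif R gT) <= eps]].

(* Main.v *)
Require Import Defs.
From HB Require Import structures.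
From mathcomp Require Import all_boot all_order all_algebra all_fingroup.
From mathcomp Require Import finmap.
From mathcomp Require Import all_classical all_reals all_analysis.
From mathcomp Require Import ring lra.

(** Group the steps X_1, ..., X_n into clusters, two steps being in the same
cluster when their values stem from the same fresh sample of mu.  Let N_n be the
number of clusters with a single element.  Given the clusters and the samples
used by the larger ones, S_n is a product of N_n independent mu-distributed
factors interleaved with constants.  Because mu is a class function, convolution
by mu commutes with translations ([iter_walk_op_right]), so all the constants
can be gathered in a single one ([fill_walk]); a translation does not change the
distance to the uniform law, which is therefore the distance d(N_n) of the
classical walk at time N_n.  Averaging ([tv_step_law], [lazy_fresh_tv]), the
distance d_n between the law of S_n and the uniform law satisfies
  d_n <= E d(N_n) <= eps / 2 + P (N_n < t)   with t = t_mix^(0)(eps / 2).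

Whether the k-th step remains alone in its cluster depends on the future, which
makes this conditioning awkward along the time evolution.  The principle of
deferred decisions avoids it: the sample of a cluster is revealed only when the
cluster is picked for the first time ([step_lawE]).  The process of partly
revealed step sequences is again a Markov process, and N_n is the number of its
unrevealed entries.

The remaining point is the lower tail of N_n ([unsampled_mgf]).  N_n increases
by 1 with probability 1 - alpha and decreases by 1 with probability
alpha * N_n / n, so H_n(y) = E (1 - y)^(N_n) satisfies
  H_(n+1)(y) = A H_n(y) - (alpha / n) y H_n'(y),   A = 1 - (1 - alpha) y.
As H_n is convex, the right-hand side is at most A H_n((1 - d) y) with
d = alpha / (n A), and by induction H_n(y) <= exp (- c n y) whenever
c (alpha + A) <= (1 - alpha) A.  Markov's inequality then yields
  P (N_n < t) <= (1 - y)^(-t) exp (- c n y).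
The choice y = 1/2, c = (1 - alpha) / 2 gives the explicit bound.  As y tends to
0 one may let c tend to (1 - alpha) / (1 + alpha), the growth rate of E N_n,
which gives the asymptotic bound. *)

Set Implicit Arguments.
Unset Strict Implicit.
Unset Printing Implicit Defensive.

Import Order.TTheory GRing.Theory Num.Theory.
Import numFieldNormedType.Exports.

Local Open Scope classical_set_scope.
Local Open Scope ring_scope.

(** * Linear functionals *)

Definition linear_functional (R : realType) (T : Type) (E : (T -> R) -> R) :=
  forall (a : R) (f g : T -> R), E (fun x => a * f x + g x) = a * E f + E g.

Section LinearFunctional.
Context (R : realType) (T : Type) (E : (T -> R) -> R).
Hypothesis E_lin : linear_functional E.

Lemma linear_functional0 : E (fun=> 0) = 0.
Proof.
have := E_lin (-1) (fun=> 0) (fun=> 0).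
rewrite (_ : (fun _ => _) = (fun=> 0)); last first.
  by apply/funext => x; rewrite mulr0 addr0.
by rewrite mulN1r addNr.
Qed.

Lemma linear_functionalZ (a : R) f : E (fun x => a * f x) = a * E f.
Proof.
have := E_lin a f (fun=> 0); rewrite linear_functional0 addr0 => <-.
by congr E; apply/funext => x; rewrite addr0.
Qed.

Lemma linear_functional_sum (I : finType) (c : I -> R) (f : I -> T -> R) :
  E (fun x => \sum_i c i * f i x) = \sum_i c i * E (f i).
Proof.
elim: (index_enum I) => [|i r IH].
  rewrite big_nil -[RHS]linear_functional0.
  by congr E; apply/funext => x; rewrite big_nil.
rewrite big_cons -IH -E_lin.
by congr E; apply/funext => x; rewrite big_cons.
Qed.

End LinearFunctional.

(** * Partly revealed step sequences *)

Section Walk.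
Context (R : realType) (gT : finGroupType) (mu : gT -> R).

(** Step sequences are listed from the latest step to the first one, so that a
new step is a cons and the walk multiplies on the right. *)
Definition walk (X : seq gT) : gT := foldr (fun x a => (a * x)%g) 1%g X.

(** In a partly revealed step sequence, [None] stands for a step whose sample
has not been drawn yet: [fill s f] is the mean of [f] over independent samples
of [mu] at all these places. *)
Fixpoint fill (s : seq (option gT)) (f : seq gT -> R) : R :=
  match s with
  | [::] => f [::]
  | Some x :: s' => fill s' (fun X => f (x :: X))
  | None :: s' => \sum_z mu z * fill s' (fun X => f (z :: X))
  end.

Lemma fill_linear s : linear_functional (fill s).
Proof.
elim: s => [|[x|] s IH] a f g //=.
rewrite mulr_sumr -big_split /=; apply: eq_bigr => z _.
by rewrite (IH a (fun X => f (z :: X)) (fun X => g (z :: X))) mulrDr mulrCA.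
Qed.

(** A quantity that depends on the [p]-th entry may be averaged by drawing this
entry first, since the samples are independent. *)
Lemma fill_nth (s : seq (option gT)) p (F : gT -> seq gT -> R) :
  (p < size s)%N ->
  fill s (fun X => F (nth 1%g X p) X) =
  if nth None s p is Some x then fill s (F x)
  else \sum_z mu z * fill (set_nth None s p (Some z)) (F z).
Proof.
elim: s p F => [//|o s IH] [|p] F /=; first by case: o.
rewrite ltnS => ps; case: o => [y|] /=.
  by rewrite (IH p (fun a X => F a (y :: X))).
under eq_bigr => y _ do rewrite (IH p (fun a X => F a (y :: X)))//.
case: (nth None s p) => // {IH}.
under eq_bigr => y _ do rewrite mulr_sumr.
rewrite exchange_big /=; apply: eq_bigr => z _; rewrite mulr_sumr.
by apply: eq_bigr => y _; rewrite mulrCA.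
Qed.

(** The transition operator of the random walk with independent steps. *)
Definition walk_op (f : gT -> R) : gT -> R :=
  fun g => \sum_z mu z * f (g * z)%g.

Lemma walk_opE f g : walk_op f g = \sum_z mu z * f (g * z)%g.
Proof. by []. Qed.

Definition unsampled (s : seq (option gT)) : nat := count (pred1 None) s.

Lemma iter_walk_op_sum (I : finType) k (f : I -> gT -> R) g :
  iter k walk_op (fun h => \sum_i f i h) g = \sum_i iter k walk_op (f i) g.
Proof.
elim: k g => [//|k IH] g; rewrite iterS walk_opE.
under eq_bigr => z _ do rewrite IH mulr_sumr.
by rewrite exchange_big.
Qed.

Lemma iter_walk_op_left k (f : gT -> R) a g :
  iter k walk_op (fun h => f (a * h)%g) g = iter k walk_op f (a * g)%g.
Proof.
elim: k g => [//|k IH] g; rewrite !iterS !walk_opE.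
by apply: eq_bigr => z _; rewrite IH mulgA.
Qed.

Lemma iter_walk_op_ge0 k (f : gT -> R) g : (forall x, 0 <= mu x) ->
  (forall h, 0 <= f h) -> 0 <= iter k walk_op f g.
Proof.
move=> mu0 f0; elim: k g => [//|k IH] g; rewrite iterS walk_opE.
by apply: sumr_ge0 => z _; exact: mulr_ge0.
Qed.

Lemma iter_walk_op_cst k (c : R) g : \sum_x mu x = 1 ->
  iter k walk_op (fun=> c) g = c.
Proof.
move=> mu1; elim: k g => [//|k IH] g; rewrite iterS walk_opE.
under eq_bigr => z _ do rewrite IH.
by rewrite -mulr_suml mu1 mul1r.
Qed.

(** Reindexing by a conjugation exchanges the step and the translation; this is
where [mu] being a class function is used. *)
Lemma iter_walk_op_right k (f : gT -> R) x g : class_pmf mu ->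
  iter k walk_op (fun h => f (h * x)%g) g = iter k walk_op f (g * x)%g.
Proof.
move=> muJ; elim: k g => [//|k IH] g; rewrite !iterS !walk_opE.
rewrite (reindex_inj (conjg_inj x^-1%g)) /=; apply: eq_bigr => z _.
have -> : mu (z ^ x^-1)%g = mu z by rewrite conjgE mulgA muJ.
by rewrite IH conjgE invgK !mulgA mulgKV.
Qed.

(** The revealed entries contribute a mere translation: each of them can be
moved through the unrevealed ones by [iter_walk_op_right]. *)
Lemma fill_walk (s : seq (option gT)) (f : gT -> R) : class_pmf mu ->
  fill s (f \o walk) = iter (unsampled s) walk_op f (walk (pmap id s)).
Proof.
move=> muJ; elim: s f => [//|[x|] s IH] f /=.
  by rewrite add0n (IH (fun h => f (h * x)%g)) iter_walk_op_right.
under eq_bigr => z _ do rewrite (IH (fun h => f (h * z)%g)).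
rewrite add0n -iterS iterSr.
rewrite (iter_walk_op_sum _ (fun z h => mu z * f (h * z)%g)).
apply: eq_bigr => z _.
elim: (unsampled s) (walk _) => [//|k IHk] g; rewrite !iterS !walk_opE.
by rewrite mulr_sumr; apply: eq_bigr => y _; rewrite -IHk mulrCA.
Qed.

(** The law at time [k] of the walk with independent [mu]-distributed steps. *)
Definition fresh_law k : gT -> R :=
  fun g => iter k walk_op (fun h => (h == g)%:R) 1%g.

Definition fresh_tv k : R := tv_dist (fresh_law k) (@unif R gT).

Lemma iter_walk_opE k a g :
  iter k walk_op (fun h => (h == g)%:R) a = fresh_law k (a^-1 * g)%g.
Proof.
rewrite /fresh_law -[a in LHS]mulg1 -iter_walk_op_left.
congr (iter k walk_op _ 1%g); apply/funext => h.
by rewrite -[h == (a^-1 * g)%g](inj_eq (mulgI a)) mulKVg.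
Qed.

(** A translation permutes the group and preserves the uniform law. *)
Lemma fresh_tv_shift k a :
  2^-1 * \sum_g `|iter k walk_op (fun h => (h == g)%:R) a - @unif R gT g| =
  fresh_tv k.
Proof.
rewrite /fresh_tv /tv_dist; congr *%R.
rewrite (reindex_inj (mulgI a)) /=; apply: eq_bigr => g _.
by rewrite iter_walk_opE mulKg.
Qed.

Lemma fresh_tv_le1 k : is_pmf mu -> fresh_tv k <= 1.
Proof.
move=> [mu0 mu1].
have law0 g : 0 <= fresh_law k g by exact: iter_walk_op_ge0.
have law1 : \sum_g fresh_law k g = 1.
  rewrite -iter_walk_op_sum -[RHS](iter_walk_op_cst k 1 1%g mu1).
  congr (iter k walk_op _ 1%g); apply/funext => h.
  rewrite (bigD1 h) //= eqxx big1 ?addr0//.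
  by move=> i /negPf; rewrite eq_sym => ->.
have unif1 : \sum_g @unif R gT g = 1.
  rewrite sumr_const -[RHS](@mulfV _ #|gT|%:R) ?mulr_natl//.
  by rewrite pnatr_eq0 -lt0n; apply/card_gt0P; exists 1%g.
rewrite /fresh_tv /tv_dist -(ler_pM2l (x := 2))// mulrA mulfV// mul1r mulr1.
rewrite [2]mulr2n -{1}law1 -unif1 -big_split /=.
apply: ler_sum => g _; apply: le_trans (ler_normB _ _) _.
by rewrite (ger0_norm (law0 g)) ger0_norm // /unif invr_ge0.
Qed.

(** * Deferred decisions *)

Section Reinforced.
Variable alpha : R.

(** The expectation of [f (X_(n+1) :: ... :: X_1)].  The index [n] is one less
than the time, so that the first step is the base case; [p] is the uniform
position of the copied step. *)
Fixpoint step_law n (f : seq gT -> R) : R :=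
  if n is m.+1 then
    step_law m (fun X => (1 - alpha) * (\sum_z mu z * f (z :: X))
      + alpha / m.+1%:R * \sum_(p < m.+1) f (nth 1%g X p :: X))
  else \sum_z mu z * f [:: z].

(** Copying the [p]-th step draws its sample if it is still unknown, and writes
the value at both places: neither is alone in its cluster any more. *)
Definition lazy_pick (f : seq (option gT) -> R) s p : R :=
  if nth None s p is Some x then f (Some x :: s)
  else \sum_z mu z * f (Some z :: set_nth None s p (Some z)).

Fixpoint lazy_law n (f : seq (option gT) -> R) : R :=
  if n is m.+1 then
    lazy_law m (fun s => (1 - alpha) * f (None :: s)
      + alpha / m.+1%:R * \sum_(p < m.+1) lazy_pick f s p)
  else f [:: None].

Lemma lazy_law_linear n : linear_functional (lazy_law n).
Proof.
elim: n => [|n IH] a f g //=; rewrite -IH; congr lazy_law; apply/funext => s.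
have -> : \sum_(p < n.+1) lazy_pick (fun x => a * f x + g x) s p
  = a * (\sum_(p < n.+1) lazy_pick f s p) + \sum_(p < n.+1) lazy_pick g s p.
  rewrite mulr_sumr -big_split /=; apply: eq_bigr => p _.
  rewrite /lazy_pick; case: nth => // ; rewrite mulr_sumr -big_split /=.
  by apply: eq_bigr => z _; rewrite mulrDr mulrCA.
by ring.
Qed.

Lemma size_set_nth_lt (s : seq (option gT)) p o :
  (p < size s)%N -> size (set_nth None s p o) = size s.
Proof. by move=> ps; rewrite size_set_nth; apply/maxn_idPr. Qed.

Lemma lazy_law_eq n f g : (forall s, size s = n.+1 -> f s = g s) ->
  lazy_law n f = lazy_law n g.
Proof.
elim: n f g => [|n IH] f g fg /=; first exact: fg.
apply: IH => s ss; congr (_ * _ + _ * _); first by apply: fg; rewrite /= ss.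
apply: eq_bigr => p _; rewrite /lazy_pick.
case: nth => [x|]; first by apply: fg; rewrite /= ss.
apply: eq_bigr => z _; congr *%R; apply: fg.
by rewrite /= size_set_nth_lt ss.
Qed.

(** Deferred decisions: one may run the process on partly revealed sequences
and draw the missing samples at the end. *)
Lemma step_lawE n f : step_law n f = lazy_law n (fun s => fill s f).
Proof.
elim: n f => [//|n IH] f /=; rewrite IH; apply: lazy_law_eq => s ss.
rewrite fill_linear (linear_functional_sum (fill_linear s)).
rewrite (linear_functionalZ (fill_linear s)).
under [X in fill s X]eq_fun => X do under eq_bigr => p _ do rewrite -[f _]mul1r.
rewrite (linear_functional_sum (fill_linear s)).
congr (_ + _ * _); apply: eq_bigr => p _; rewrite mul1r.
by rewrite (fill_nth (fun x X => f (x :: X))) ?ss.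
Qed.

Lemma step_law_linear n : linear_functional (step_law n).
Proof.
move=> a f g; rewrite !step_lawE -lazy_law_linear; apply: lazy_law_eq => s _.
exact: fill_linear.
Qed.

Lemma step_lawS n f : step_law n.+1 f =
  (1 - alpha) * (\sum_z mu z * step_law n (fun X => f (z :: X)))
  + alpha / n.+1%:R *
    \sum_(p < n.+1) step_law n (fun X => f (nth 1%g X p :: X)).
Proof.
have lin := step_law_linear n.
rewrite /= lin (linear_functionalZ lin) (linear_functional_sum lin).
congr (_ + _ * _); under [RHS]eq_bigr => p _ do rewrite -[step_law _ _]mul1r.
rewrite -(linear_functional_sum lin); congr step_law; apply/funext => X.
by apply: eq_bigr => p _; rewrite mul1r.
Qed.

Hypothesis mu_pmf : is_pmf mu.
Hypothesis alpha01 : 0 <= alpha < 1.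

Lemma lazy_law_le n f g : (forall s, size s = n.+1 -> f s <= g s) ->
  lazy_law n f <= lazy_law n g.
Proof.
case: mu_pmf => mu0 mu1; case/andP: alpha01 => a0 a1.
elim: n f g => [|n IH] f g fg /=; first exact: fg.
apply: IH => s ss; apply: lerD.
  by apply: ler_wpM2l; [rewrite subr_ge0 ltW|apply: fg; rewrite /= ss].
apply: ler_wpM2l; first by rewrite divr_ge0.
apply: ler_sum => p _; rewrite /lazy_pick.
case: nth => [x|]; first by apply: fg; rewrite /= ss.
apply: ler_sum => z _; apply: ler_wpM2l => //; apply: fg.
by rewrite /= size_set_nth_lt ss.
Qed.

Lemma lazy_law_cst n (c : R) : lazy_law n (fun=> c) = c.
Proof.
case: mu_pmf => mu0 mu1.
elim: n => [//|n IH] /=; rewrite -[RHS]IH; congr lazy_law; apply/funext => s.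
have -> : \sum_(p < n.+1) lazy_pick (fun=> c) s p = n.+1%:R * c.
  rewrite (eq_bigr (fun=> c)) => [|p _].
    by rewrite sumr_const card_ord mulr_natl.
  by rewrite /lazy_pick; case: nth => //; rewrite -mulr_suml mu1 mul1r.
by rewrite mulrA divfK ?pnatr_eq0// -mulrDl subrK mul1r.
Qed.

Lemma lazy_law_norm n f : `|lazy_law n f| <= lazy_law n (fun s => `|f s|).
Proof.
rewrite ler_norml; apply/andP; split; last first.
  by apply: lazy_law_le => s _; exact: ler_norm.
rewrite -mulN1r -(linear_functionalZ (lazy_law_linear n)).
by apply: lazy_law_le => s _; rewrite mulN1r lerNl -normrN ler_norm.
Qed.

(** The total variation distance is convex, and for each partly revealed
sequence [fill_walk] and [fresh_tv_shift] reduce it to the classical walk. *)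
Lemma tv_step_law n : class_pmf mu ->
  tv_dist (fun g => step_law n (fun X => (walk X == g)%:R)) (@unif R gT)
  <= lazy_law n (fun s => fresh_tv (unsampled s)).
Proof.
move=> muJ; rewrite /tv_dist.
under eq_bigr => g _.
  rewrite step_lawE -[@unif R gT g](lazy_law_cst n).
  rewrite -[X in `|_ - X|]mul1r -mulNr addrC -lazy_law_linear.
  over.
apply: (@le_trans _ _ (2^-1 * \sum_g lazy_law n (fun s =>
    `|iter (unsampled s) walk_op (fun h => (h == g)%:R) (walk (pmap id s))
      - @unif R gT g|))).
  rewrite ler_pM2l ?invr_gt0//; apply: ler_sum => g _.
  apply: le_trans (lazy_law_norm _ _) _; apply: lazy_law_le => s _.
  by rewrite mulN1r addrC (fill_walk s (fun h => (h == g)%:R)).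
under eq_bigr => g _ do rewrite -[lazy_law _ _]mul1r.
rewrite -(linear_functional_sum (lazy_law_linear n)).
rewrite -(linear_functionalZ (lazy_law_linear n)).
apply: lazy_law_le => s _; rewrite -(fresh_tv_shift _ (walk (pmap id s))).
by under eq_bigr => g _ do rewrite mul1r.
Qed.

(** * The number of unrevealed steps *)

Lemma sum_unsampled (s : seq (option gT)) m : size s = m ->
  (\sum_(p < m) (nth None s p == None))%N = unsampled s.
Proof.
move=> <-; rewrite -(big_mkord xpredT (fun p => (nth None s p == None) : nat)).
rewrite /unsampled -sum1_count (big_nth None) [RHS]big_mkcond.
by apply: eq_bigr => i _ /=; case: (_ == _).
Qed.

Lemma unsampled_set_nth (s : seq (option gT)) p z :
  (p < size s)%N -> nth None s p = None ->
  unsampled (set_nth None s p (Some z)) = (unsampled s).-1.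
Proof.
by move=> ps sp; rewrite /unsampled count_set_nth_ltn// sp /= addn0 subn1.
Qed.

(** The convex function [x ^+ N] lies above its tangents. *)
Lemma tangent_expr (x e : R) N : 0 <= x -> 0 <= e ->
  x ^+ N + N%:R * e * x ^+ N.-1 <= (x + e) ^+ N.
Proof.
move=> x0 e0; elim: N => [|N IH]; first by rewrite !mul0r addr0.
apply: (@le_trans _ _ ((x + e) * (x ^+ N + N%:R * e * x ^+ N.-1))); last first.
  by rewrite exprS ler_wpM2l// addr_ge0.
case: N {IH} => [|N] /=; first by rewrite !expr0 expr1; lra.
rewrite -subr_ge0 [_ - _](_ : _ = N.+1%:R * e ^+ 2 * x ^+ N).
  by rewrite !mulr_ge0// exprn_ge0.
by rewrite -[N.+2%:R]natr1 !exprS; ring.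
Qed.

(** One step of the recursion replaces [y] by the smaller [(1 - d) * y] while [c]
has to stay the same: hence the range [0 <= y <= y0].  The condition on [c] says
[c + c * alpha / A <= 1 - alpha] for [A] taken at [y0], where it is smallest:
the factor [A <= exp (- (1 - alpha) * y)] gained at each step has to pay for the
growth [c] of the exponent and for its loss [c * (n * d) = c * alpha / A]. *)
Lemma unsampled_mgf n (c y0 y : R) : 0 <= c -> y0 < 1 ->
  c * (alpha + (1 - (1 - alpha) * y0))
    <= (1 - alpha) * (1 - (1 - alpha) * y0) ->
  0 <= y <= y0 ->
  lazy_law n (fun s => (1 - y) ^+ unsampled s) <= expR (- (c * n.+1%:R * y)).
Proof.
move=> c0 y01 hc; case: mu_pmf => mu0 mu1; case/andP: alpha01 => a0 a1.
have A0 : 0 < 1 - (1 - alpha) * y0 by nra.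
have ca : c <= 1 - alpha.
  rewrite -(ler_pM2r A0); apply: le_trans hc.
  by apply: ler_wpM2l => //; rewrite lerDr.
elim: n y => [|n IH] y /andP[y_ge0 yy0].
  rewrite /= /unsampled /= mulr1; apply: le_trans (expR_ge1Dx _).
  by rewrite lerD2l lerN2 -[leRHS]mul1r ler_wpM2r//; lra.
set A := 1 - (1 - alpha) * y.
have AA0 : 1 - (1 - alpha) * y0 <= A by rewrite /A; nra.
have A_gt0 : 0 < A by lra.
have aA : alpha <= A by rewrite /A; nra.
have hcA : c * alpha <= (1 - alpha - c) * A by nra.
pose d := alpha / (n.+1%:R * A).
have n0 : (0 : R) < n.+1%:R by rewrite ltr0n.
have nA0 : 0 < n.+1%:R * A by exact: mulr_gt0.
have d0 : 0 <= d by rewrite divr_ge0// ltW.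
have dE : d * n.+1%:R * A = alpha by rewrite -mulrA divfK// gt_eqF.
have d1 : d <= 1.
  rewrite ler_pdivrMr// mul1r (le_trans aA)//.
  by apply: ler_peMl; [exact: ltW|rewrite ler1n].
have y1 : 0 <= 1 - y by lra.
(* One step of the chain; the tangent of x ^+ N at x = 1 - y, with increment
   d * y, absorbs the loss caused by picking an unrevealed step. *)
apply: (@le_trans _ _
  (A * lazy_law n (fun s => (1 - (1 - d) * y) ^+ unsampled s))).
  rewrite /= -(linear_functionalZ (lazy_law_linear n)).
  apply: lazy_law_le => s ss.
  pose N := unsampled s.
  have -> : \sum_(p < n.+1) lazy_pick (fun s => (1 - y) ^+ unsampled s) s p
    = n.+1%:R * (1 - y) ^+ N + N%:R * ((1 - y) ^+ N.-1 - (1 - y) ^+ N).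
    have -> : N%:R = \sum_(p < n.+1) ((nth None s p == None)%:R : R).
      by rewrite -natr_sum sum_unsampled.
    rewrite mulr_suml -[n.+1 in X in _ = X + _](card_ord n.+1) mulr_natl.
    rewrite -sumr_const -big_split /=.
    apply: eq_bigr => p _; rewrite /lazy_pick.
    case E: nth => [x|].
      by rewrite mul0r addr0.
    under eq_bigr => z _ do rewrite /unsampled /= -/(unsampled _)
      unsampled_set_nth ?ss//.
    by rewrite -mulr_suml mu1 !mul1r addrCA subrr addr0.
  have := tangent_expr N y1 (mulr_ge0 d0 y_ge0).
  move=> /(ler_wpM2l (ltW A_gt0)).
  rewrite (_ : 1 - y + d * y = 1 - (1 - d) * y); last by ring.
  apply: le_trans; rewrite le_eqVlt; apply/orP; left; apply/eqP.
  rewrite /unsampled /= -/(unsampled _) -/N add1n exprS.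
  have aE : alpha / n.+1%:R = d * A.
    by rewrite -dE mulrAC mulfK// gt_eqF.
  rewrite [alpha / _ * _]mulrDr [alpha / _ * (n.+1%:R * _)]mulrA.
  rewrite divfK ?gt_eqF//.
  rewrite aE.
  have NE : N%:R * ((1 - y) ^+ N.-1 - (1 - y) ^+ N)
      = N%:R * (y * (1 - y) ^+ N.-1).
    by case: (N) => [|k] /=; rewrite ?mul0r// exprS; ring.
  by rewrite NE /A; ring.
have /IH{}IH : 0 <= (1 - d) * y <= y0.
  rewrite mulr_ge0 ?subr_ge0//=; apply: le_trans yy0.
  by rewrite ler_piMl//; lra.
apply: le_trans (ler_wpM2l (ltW A_gt0) IH) _.
apply: (@le_trans _ _
  (expR (- ((1 - alpha) * y)) * expR (- (c * n.+1%:R * ((1 - d) * y))))).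
  apply: ler_wpM2r; first exact: expR_ge0.
  exact: expR_ge1Dx.
rewrite -expRD ler_expR -opprD lerN2.
(* As d * n.+1 = alpha / A, this is the condition on c. *)
have cd : c * (d * n.+1%:R) <= 1 - alpha - c.
  by rewrite -(ler_pM2r A_gt0) -mulrA dE.
rewrite -[n.+2%:R]natr1.
have := ler_wpM2r y_ge0 cd; lra.
Qed.

(** The distance [fresh_tv k] is at most [eps] for [t <= k] and at most 1 for
[k < t]; the indicator of the latter is bounded by [(1 - y) ^ (k - t)]. *)
Lemma lazy_fresh_tv n t (eps c y : R) : 0 <= c -> 0 < y < 1 ->
  c * (alpha + (1 - (1 - alpha) * y)) <= (1 - alpha) * (1 - (1 - alpha) * y) ->
  0 <= eps -> (forall k, (t <= k)%N -> fresh_tv k <= eps) ->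
  lazy_law n (fun s => fresh_tv (unsampled s))
  <= eps + (1 - y) ^- t * expR (- (c * n.+1%:R * y)).
Proof.
move=> c0 /andP[y0 y1] hc eps0 ht.
have x0 : 0 < 1 - y by lra.
apply: (@le_trans _ _
  (lazy_law n (fun s => (1 - y) ^- t * (1 - y) ^+ unsampled s + eps))).
  apply: lazy_law_le => s _; have [ts|ts] := leqP t (unsampled s).
    by apply: ler_wpDl; [rewrite mulr_ge0 ?invr_ge0 ?exprn_ge0// ltW|exact: ht].
  apply: ler_wpDr => //; apply: le_trans (fresh_tv_le1 _ mu_pmf) _.
  rewrite mulrC ler_pdivlMr ?exprn_gt0// mul1r.
  by apply: ler_wiXn2l; [exact: ltW|lra|exact: ltnW].
rewrite (lazy_law_linear n _ (fun s => (1 - y) ^+ unsampled s) (fun=> eps)).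
rewrite lazy_law_cst addrC lerD2l ler_wpM2l//.
  by rewrite invr_ge0 exprn_ge0// ltW.
by apply: unsampled_mgf hc _ => //; rewrite lexx ltW.
Qed.

End Reinforced.

Lemma step_law0 n f :
  step_law 0 n f = fill (nseq n.+1 None) f.
Proof.
rewrite step_lawE.
suff L m (g : seq (option gT) -> R) : lazy_law 0 m g = g (nseq m.+1 None).
  by rewrite L.
elim: m g => [//|m IH] g /=.
by rewrite IH subr0 mul1r !mul0r addr0.
Qed.

End Walk.

(** * The law of the steps of a realization of the walk *)

Lemma measure_partition (R : realType) (d : measure_display)
    (T : measurableType d) (P : probability T R) (I : finType) (V : T -> I)
    (B : set T) :
  (forall i, measurable (B `&` V @^-1` [set i])) ->
  measurable B /\ fine (P B) = \sum_i fine (P (B `&` V @^-1` [set i])).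
Proof.
move=> mB; have finI : finite_set [set: I] by exact: finite_finset.
have BE : B = \bigcup_(i in [set: I]) (B `&` V @^-1` [set i]).
  apply/seteqP; split => [w Bw|w [i _ []]//].
  by exists (V w).
have mBB : measurable B.
  by rewrite BE; apply: fin_bigcup_measurable => // i _; exact: mB.
split=> //; apply: EFin_inj; rewrite -sumEFin fineK ?fin_num_measure//.
rewrite [in LHS]BE measure_fin_bigcup//.
  rewrite (fsbigE (index_enum I)) ?index_enum_uniq//.
    by apply: eq_big => [i|i _]; rewrite ?in_setT// fineK ?fin_num_measure.
  by move=> i _; rewrite mem_index_enum.
by move=> i j _ _ [w [[_ <-] [_ <-]]].
Qed.

Section SRRWLaw.
Context (R : realType) (gT : finGroupType) (mu : gT -> R) (alpha : R).
Context (W : SRRW mu alpha).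

Let T := srrw_space W.
Let P := srrw_prob W.
Let idx : choiceType := (nat + nat + nat)%type.
Let events : idx -> set (set T) :=
  source_events (srrw_xi W) (srrw_u W) (srrw_Z W).

Definition source_time (i : nat + nat + nat) : nat :=
  match i with inl (inl n) => n | inl (inr n) => n | inr n => n end.

(** Events about sources of randomness that the steps up to time [k] do not use. *)
Definition later_sources (k : nat) (l : seq idx) (E : idx -> set T) : Prop :=
  uniq l /\ forall i, i \in l ->
    [/\ source_index i, (k < source_time i)%N & events i (E i)].

Definition override (E : idx -> set T) i A : idx -> set T :=
  fun j => if j == i then A else E j.

Lemma override_neq (E : idx -> set T) i A j : j != i -> override E i A j = E j.
Proof. by rewrite /override => /negPf ->. Qed.

Lemma big_override (S : Type) (id : S) (op : S -> S -> S) (F : set T -> S)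
    (l : seq idx) (E : idx -> set T) i A : i \notin l ->
  \big[op/id]_(j <- i :: l) F (override E i A j) =
  op (F A) (\big[op/id]_(j <- l) F (E j)).
Proof.
move=> il; rewrite big_cons {1}/override eqxx; congr op.
apply: eq_big_seq => j jl; rewrite override_neq//.
by apply: contraNneq il => <-.
Qed.

Lemma later_sources_cons k l E i A : later_sources k l E -> i \notin l ->
  source_index i -> (k < source_time i)%N -> events i A ->
  later_sources k (i :: l) (override E i A).
Proof.
move=> [ul hl] il si ki Ai; split=> [|j]; first by rewrite /= il.
rewrite in_cons => /predU1P[->|jl]; first by rewrite /override eqxx.
by rewrite override_neq; [exact: hl|apply: contraNneq il => <-].
Qed.

Lemma later_sourcesW k k' l E : (k <= k')%N ->
  later_sources k' l E -> later_sources k l E.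
Proof.
move=> kk' [ul hl]; split=> // i /hl[si ki Ei]; split=> //.
exact: leq_ltn_trans ki.
Qed.

Lemma measurable_sources k l E : later_sources k l E ->
  measurable (\big[setI/setT]_(i <- l) E i).
Proof.
move=> [ul hl]; rewrite big_seq; apply: bigsetI_measurable => i /hl[si _ Ei].
exact: srrw_meas Ei.
Qed.

Lemma fine_sources k l E : later_sources k l E ->
  fine (P (\big[setI/setT]_(i <- l) E i)) = \prod_(i <- l) fine (P (E i)).
Proof.
move=> [ul hl]; have eql : perm_eq [fset i in l]%fset l.
  by apply: uniq_perm => // i; rewrite !inE.
have := @srrw_indep _ _ _ _ W [fset i in l]%fset E.
rewrite bigcap_fset !(perm_big _ eql) -/P => ->.
- rewrite (eq_big_seq (fun i => (fine (P (E i)))%:E)) ?prodEFin// => i.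
  move=> /hl[si _ Ei].
  by rewrite fineK// fin_num_measure//; exact: srrw_meas Ei.
- by move=> i /=; rewrite !inE => /hl[].
- by move=> i; rewrite !inE => /hl[].
Qed.

(** [steps n] lists the steps of times [n.+1], ..., 1. *)
Fixpoint steps n (w : T) : seq gT :=
  if n is m.+1 then srrw_X W m.+2 w :: steps m w else [:: srrw_X W 1 w].

Lemma nth_steps n w p : (p <= n)%N ->
  nth 1%g (steps n w) p = srrw_X W (n.+1 - p) w.
Proof.
elim: n p => [|n IH] [|p] //=; first by rewrite ltnS => /IH ->; rewrite subSS.
Qed.

Lemma walk_steps n w : walk (steps n w) = srrw_S W n.+1 w.
Proof.
elim: n => [|n IH] /=; first by rewrite srrw_Sn srrw_S0.
by rewrite IH [RHS]srrw_Sn.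
Qed.

Lemma xi_law n b : (2 <= n)%N ->
  fine (P (srrw_xi W n @^-1` [set b])) = if b then alpha else 1 - alpha.
Proof.
move=> n2; have h := srrw_xi_law W n2; case: b; first by rewrite /P h.
rewrite (_ : _ @^-1` _ = ~` (srrw_xi W n @^-1` [set true])).
  rewrite probability_setC; first by rewrite /P h.
  by apply: (@srrw_meas _ _ _ _ W (inl (inl n))) => //; exists [set true].
by apply/seteqP; split=> w /=; case: (srrw_xi W n w).
Qed.

(** Only the independence of events attached to single sources is given.
Carrying an arbitrary family of later sources through the induction replaces
the independence of the past steps from the future: splitting along the values
of the sources of time [n.+2] moves these sources into the family. *)
Lemma joint_law n (f : pred (seq gT)) (l : seq idx) (E : idx -> set T) :
  later_sources n.+1 l E ->
  let B := [set w | f (steps n w)] `&` \big[setI/setT]_(i <- l) E i in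
  measurable B /\
  fine (P B) =
    step_law mu alpha n (fun X => (f X)%:R) * \prod_(i <- l) fine (P (E i)).
Proof.
elim: n f l E => [|n IH] f l E lE; set C := \big[setI/setT]_(i <- l) E i => B.
  pose l' z := override E (inr 1%N) (srrw_Z W 1 @^-1` [set z]).
  have nl : inr 1%N \notin l by apply/negP => /(proj2 lE)[].
  have lE' z : later_sources 0 (inr 1%N :: l) (l' z).
    apply: later_sources_cons => //; first exact: later_sourcesW lE.
    by exists [set z].
  have piece z : B `&` srrw_Z W 1 @^-1` [set z] =
      if f [:: z] then srrw_Z W 1 @^-1` [set z] `&` C else set0.
    rewrite /B /=; apply/seteqP; split=> w /=.
      by rewrite srrw_X1 => -[[fw Cw] zw]; rewrite -zw fw.
    by case: ifP => // fz [zw Cw]; rewrite srrw_X1 zw.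
  have [z|mB ->] := @measure_partition _ _ _ P _ (srrw_Z W 1) B.
    rewrite piece; case: ifP => // _.
    by have := measurable_sources (lE' z); rewrite (big_override _ _ id).
  split=> //=; rewrite mulr_suml; apply: eq_bigr => z _.
  rewrite piece; case: ifP => _; last by rewrite measure0 mulr0 mul0r.
  have := fine_sources (lE' z); rewrite (big_override _ _ id)// -/C => ->.
  rewrite (big_override _ _ (fun A => fine (P A)))//.
  by rewrite /P srrw_Z_law// mulr1.
pose m := n.+2; pose xi := srrw_xi W m; pose u := srrw_u W m.
have u_range w : (1 <= u w <= n.+1)%N by exact: srrw_u_range.
(* The new step is a sample of mu or the copy of a position: V records which,
   and the sources of time m determine it. *)
pose V w : (gT + 'I_n.+1)%type :=
  if xi w then inr (inord (n.+1 - u w)) else inl (srrw_Z W m w).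
have nl i : source_time i = m -> i \notin l.
  by move=> im; apply/negP => /(proj2 lE)[_]; rewrite im ltnn.
pose El z := override (override E (inr m) (srrw_Z W m @^-1` [set z]))
  (inl (inl m)) (xi @^-1` [set false]).
pose Er (p : 'I_n.+1) :=
  override (override E (inl (inr m)) (u @^-1` [set (n.+1 - p)%N]))
  (inl (inl m)) (xi @^-1` [set true]).
have lE1 := later_sourcesW (leqnSn n.+1) lE.
have lEl z : later_sources n.+1 [:: inl (inl m), inr m & l] (El z).
  apply: later_sources_cons => //; first apply: later_sources_cons => //.
  - exact: nl.
  - by exists [set z].
  - by rewrite in_cons negb_or /=; exact: nl.
  - by exists [set false].
have lEr p : later_sources n.+1 [:: inl (inl m), inl (inr m) & l] (Er p).
  apply: later_sources_cons => //; first apply: later_sources_cons => //.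
  - exact: nl.
  - by exists [set (n.+1 - p)%N].
  - by rewrite in_cons negb_or /=; exact: nl.
  - by exists [set true].
have bigl (S : Type) (id : S) op (F : set T -> S) z :
    \big[op/id]_(i <- [:: inl (inl m), inr m & l]) F (El z i) =
    op (F (xi @^-1` [set false])) (op (F (srrw_Z W m @^-1` [set z]))
      (\big[op/id]_(i <- l) F (E i))).
  rewrite big_override ?big_override//; first exact: nl.
  by rewrite in_cons negb_or /=; exact: nl.
have bigr (S : Type) (id : S) op (F : set T -> S) p :
    \big[op/id]_(i <- [:: inl (inl m), inl (inr m) & l]) F (Er p i) =
    op (F (xi @^-1` [set true])) (op (F (u @^-1` [set (n.+1 - p)%N]))
      (\big[op/id]_(i <- l) F (E i))).
  rewrite big_override ?big_override//; first exact: nl.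
  by rewrite in_cons negb_or /=; exact: nl.
have piecel z : B `&` V @^-1` [set inl z] =
    [set w | f (z :: steps n w)] `&`
      \big[setI/setT]_(i <- [:: inl (inl m), inr m & l]) El z i.
  rewrite (bigl _ _ _ id) -/C /B; apply/seteqP; split=> w /=;
    rewrite srrw_Xn// -/m -/xi -/u /V.
    by case: (xi w) => -[[fw Cw] zw] //; case: zw => <-.
  by move=> [fw [xiw [zw Cw]]]; rewrite xiw zw.
have piecer p : B `&` V @^-1` [set inr p] =
    [set w | f (nth 1%g (steps n w) p :: steps n w)] `&`
      \big[setI/setT]_(i <- [:: inl (inl m), inl (inr m) & l]) Er p i.
  have pn : (p <= n)%N by rewrite -ltnS ltn_ord.
  rewrite (bigr _ _ _ id) -/C /B; apply/seteqP; split=> w /=;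
    rewrite srrw_Xn// -/m -/xi -/u /V.
    case: (xi w) => -[[fw Cw] pw] //; case: pw => /(congr1 val).
    rewrite /= inordK => [up|].
      have := u_range w => /andP[u1 un].
      have uE : u w = (n.+1 - p)%N by rewrite -up subKn.
      by rewrite nth_steps// -uE.
    by have /andP[u1 _] := u_range w; rewrite -[ltnRHS]subn0 ltn_sub2l.
  move=> [+ [xiw [uw Cw]]]; rewrite xiw uw nth_steps// => fw; split=> //.
  by congr inr; apply: val_inj; rewrite /= inordK subKn// ltnW.
have [[z|p]|mB ->] := @measure_partition _ _ _ P _ V B.
- by rewrite piecel; apply: (IH (fun X => f (z :: X)) _ _ (lEl z)).1.
- by rewrite piecer; apply: (IH (fun X => f (nth 1%g X p :: X)) _ _ (lEr p)).1.
split=> //; rewrite big_sumType step_lawS mulrDl; congr (_ + _).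
  rewrite mulr_sumr mulr_suml; apply: eq_bigr => z _.
  rewrite piecel (IH (fun X => f (z :: X)) _ _ (lEl z)).2.
  rewrite (bigl _ _ _ (fun A => fine (P A))) xi_law// /P srrw_Z_law//=.
  by ring.
rewrite mulr_sumr mulr_suml; apply: eq_bigr => p _.
rewrite piecer (IH (fun X => f (nth 1%g X p :: X)) _ _ (lEr p)).2.
rewrite (bigr _ _ _ (fun A => fine (P A))) xi_law// /P srrw_u_law//=; last first.
  by rewrite subn_gt0 ltn_ord leq_subr.
by ring.
Qed.

Lemma srrw_lawE n g :
  srrw_law W n.+1 g = step_law mu alpha n (fun X => (walk X == g)%:R).
Proof.
have [//|_] := @joint_law n (fun X => walk X == g) [::] (fun=> setT).
rewrite !big_nil setIT mulr1 => <-; rewrite /srrw_law; congr (fine (P _)).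
by apply/seteqP; split=> w /=; rewrite walk_steps => /eqP.
Qed.

End SRRWLaw.

(** * Mixing times *)

Section MixingTime.
Context (R : realType) (gT : finGroupType) (mu : gT -> R) (alpha : R).

Lemma tmix_cases (W : SRRW mu alpha) (eps : R) :
  tmix W eps = +oo%E \/
  exists t : nat, [/\ (1 <= t)%N, tmix W eps = t%:R%:E &
    forall m, (t <= m)%N -> tv_dist (srrw_law W m) (@unif R gT) <= eps].
Proof.
set M := [set n : nat | (1 <= n)%N /\ forall m, (n <= m)%N ->
  tv_dist (srrw_law W m) (@unif R gT) <= eps].
have tE : tmix W eps = ereal_inf [set n%:R%:E | n in M] by [].
have [[n Mn]|noM] := pselect (exists n, M n); last first.
  left; rewrite tE (_ : [set _ | _ in _] = set0) ?ereal_inf0//.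
  by rewrite -subset0 => ? [n Mn _]; apply: noM; exists n.
right; have exM : exists n, `[< M n >] by exists n; apply/asboolP.
have [t Mt tmin] := ex_minnP exM; have [t1 tP] := asboolW Mt.
exists t; split => //.
rewrite tE; apply/eqP; rewrite eq_le; apply/andP; split.
  by apply: ereal_inf_lbound; exists t.
apply: le_ereal_inf_tmp => _ [k Mk <-]; rewrite lee_fin ler_nat.
by apply: tmin; apply/asboolP.
Qed.

(** The mixing time is at most the least integer greater than [B]. *)
Lemma tmix_le (W : SRRW mu alpha) (eps B : R) : 0 <= B ->
  (forall m, (1 <= m)%N -> B <= m%:R ->
    tv_dist (srrw_law W m) (@unif R gT) <= eps) ->
  (tmix W eps <= (B + 1)%:E)%E.
Proof.
move=> B0 hB; pose n := (Num.trunc B).+1.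
have Bn : B < n%:R by exact: truncnS_gt.
apply: (@le_trans _ _ n%:R%:E); last first.
  by rewrite lee_fin -natr1 lerD2r truncn_le.
apply: ereal_inf_lbound; exists n => //; split => // m nm.
apply: hB; first exact: leq_trans nm.
by apply: le_trans (ltW Bn) _; rewrite ler_nat.
Qed.

(** The classical walk enters through a realization with [alpha = 0], for which no
step is ever copied.  The factor [(1 - y) ^- t] of the tail is bounded by an
exponential, since [(1 - y)^-1 = 1 + y / (1 - y)]. *)
Lemma tv_srrw_le (W0 : SRRW mu 0) (W : SRRW mu alpha) t (eps c y : R) m :
  is_pmf mu -> class_pmf mu -> 0 <= alpha < 1 -> 0 <= c -> 0 < y < 1 ->
  c * (alpha + (1 - (1 - alpha) * y)) <= (1 - alpha) * (1 - (1 - alpha) * y) ->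
  0 <= eps -> (1 <= t)%N ->
  (forall k, (t <= k)%N -> tv_dist (srrw_law W0 k) (@unif R gT) <= eps) ->
  (1 <= m)%N ->
  tv_dist (srrw_law W m) (@unif R gT)
  <= eps + expR (t%:R * (y / (1 - y)) - c * m%:R * y).
Proof.
move=> mu_pmf muJ a01 c0 y01 hc eps0 t1 ht; case: m => // n _.
have ht' k : (t <= k)%N -> fresh_tv mu k <= eps.
  move=> tk; apply: le_trans (ht k tk); case: k tk => [|k] tk.
    by rewrite leqn0 in tk; rewrite (eqP tk) in t1.
  rewrite /fresh_tv (_ : srrw_law W0 k.+1 = fresh_law mu k.+1)//.
  apply/funext => g; rewrite srrw_lawE step_law0.
  rewrite (fill_walk _ (fun h => (h == g)%:R))// /fresh_law.
  rewrite (_ : unsampled _ = k.+1).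
    by congr (iter _ _ _ _); elim: k {tk} => //= k ->.
  by rewrite /unsampled count_nseq /= mul1n.
rewrite (_ : srrw_law W n.+1 =
  fun g => step_law mu alpha n (fun X => (walk X == g)%:R)); last first.
  by apply/funext => g; rewrite srrw_lawE.
apply: le_trans (tv_step_law mu_pmf a01 n muJ) _.
apply: le_trans (lazy_fresh_tv mu_pmf a01 n c0 y01 hc eps0 ht') _.
case/andP: y01 => y0 y1.
rewrite lerD2l expRD; apply: ler_wpM2r; first exact: expR_ge0.
rewrite mulrC expRM_natr -exprVn; apply: lerXn2r; rewrite ?nnegrE ?expR_ge0//.
  by rewrite invr_ge0; lra.
apply: le_trans (expR_ge1Dx _); rewrite le_eqVlt; apply/orP; left; apply/eqP.
by field; lra.
Qed.

End MixingTime.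

(** With [y = 1 / 2] and [q = (1 - alpha) * m] the tail is at most
[exp (t - q / 4)].  If [8 t <= q] and [18 ln (4 / eps) <= q], this is at most
[exp (- q / 8) <= eps / 4]. *)
Lemma tmix_srrw_le (R : realType) (gT : finGroupType) (mu : gT -> R) (alpha : R)
    (W0 : SRRW mu 0) (W : SRRW mu alpha) (eps : R) :
  is_pmf mu -> class_pmf mu -> 0 <= alpha < 1 -> 0 < eps < 1 ->
  (tmix W eps <=
     ((1 - alpha)^-1)%:E *
       maxe (8%:E * tmix W0 (eps / 2)) (18 * ln (4 / eps))%:E + 1%:E)%E.
Proof.
move=> mu_pmf muJ a01 /andP[eps0 eps1]; case/andP: (a01) => a0 a1.
have q0 : 0 < 1 - alpha by lra.
have [->|[t [t1 -> ht]]] := tmix_cases W0 (eps / 2).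
  rewrite gt0_muley ?lte_fin// maxye gt0_muley ?lte_fin ?invr_gt0// addye//.
  exact: leey.
rewrite -EFinM -EFin_max -EFinM -EFinD.
set L := ln (4 / eps).
have L0 : 0 <= L by apply: ln_ge0; rewrite ler_pdivlMr//; lra.
apply: tmix_le => [|m m1 hm].
  by rewrite mulr_ge0 ?invr_ge0 ?(ltW q0)// le_max mulr_ge0.
have := hm; rewrite mulrC ler_pdivrMr// ge_max => /andP[tm Lm].
have := @tv_srrw_le _ _ _ _ W0 W t (eps / 2) ((1 - alpha) / 2) (1 / 2) m
  mu_pmf muJ a01.
move=> /(_ _ _ _ _ t1 ht m1) h; apply: le_trans (h _ _ _ _) _ => {h}.
- lra.
- lra.
- nra.
- lra.
rewrite [leRHS](splitr eps) lerD2l.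
apply: (@le_trans _ _ (expR (- L))); last first.
  rewrite expRN lnK ?posrE ?divr_gt0// invf_div; lra.
rewrite ler_expR (_ : 1 / 2 / (1 - 1 / 2) = 1); last by field.
lra.
Qed.

Lemma limn_esup_le_near (R : realType) (u : (\bar R)^nat) (x : \bar R) :
  (\forall n \near \oo, (u n <= x)%E) -> (limn_esup u <= x)%E.
Proof.
move=> ux; apply: (@le_trans _ _ (ereal_sup (u @` [set n | (u n <= x)%E]))).
  by apply: ereal_inf_lbound; exists [set n | (u n <= x)%E].
by apply: ge_ereal_sup => _ [n un <-].
Qed.

(** For [m >= (1 + eta) * K * t], where [K = (1 + alpha) / (1 - alpha)], the tail
is at most [exp (- t * y * eta / 2)] if [y] is small compared with [eta], and
this is at most [eps / 2] once [t] is large.  The second term of the threshold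
on [t] absorbs the rounding of the mixing time to an integer. *)
Lemma tmix_ratio_le (R : realType) (gT : finGroupType) (mu : gT -> R)
    (alpha : R) (W0 : SRRW mu 0) (W : SRRW mu alpha) (eps eta : R) :
  is_pmf mu -> class_pmf mu -> 0 <= alpha < 1 -> 0 < eps < 1 -> 0 < eta ->
  ((ln (2 / eps) * 8 * (1 + eta) / eta ^+ 2 + eta^-1)%:E
    <= tmix W0 (eps / 2))%E ->
  (tmix W eps / tmix W0 (eps / 2)
    <= ((1 + eta) * ((1 + alpha) / (1 - alpha)) + eta)%:E)%E.
Proof.
move=> mu_pmf muJ a01 /andP[eps0 eps1] eta0; case/andP: (a01) => a0 a1.
have q0 : 0 < 1 - alpha by lra.
have K0 : 0 <= (1 + alpha) / (1 - alpha) by rewrite divr_ge0; lra.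
have [->|[t [t1 -> ht]]] := tmix_cases W0 (eps / 2).
  rewrite invey mule0 lee_fin => _.
  by apply: addr_ge0; [apply: mulr_ge0 => //; lra|lra].
rewrite lee_fin => ht0.
have L0 : 0 <= ln (2 / eps) by apply: ln_ge0; rewrite ler_pdivlMr//; lra.
have t0 : 0 < t%:R :> R by rewrite ltr0n.
have [Lt et] :
    ln (2 / eps) * 8 * (1 + eta) / eta ^+ 2 <= t%:R /\ eta^-1 <= t%:R.
  split; apply: le_trans ht0; first by rewrite lerDl invr_ge0 ltW.
  by rewrite lerDr divr_ge0 ?sqr_ge0// !mulr_ge0//; lra.
set K := (1 + alpha) / (1 - alpha) in K0 *.
pose B := (1 + eta) * K * t%:R.
have B0 : 0 <= B by apply: mulr_ge0 => //; apply: mulr_ge0 => //; lra.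
have tB : (tmix W eps <= (B + 1)%:E)%E.
  apply: tmix_le => // m m1 Bm.
  (* This y makes (1 - y) * (1 + eta) = 1 + 3 * eta / 4, while
     1 / (1 - y) <= 1 + eta / 4; the difference is at least eta / 2. *)
  pose y := eta / (4 * (1 + eta)).
  have yE : y * (1 + eta) = eta / 4 by rewrite /y; field; lra.
  have y0 : 0 < y by rewrite divr_gt0//; lra.
  have y1 : y < 1 by nra.
  pose A := 1 - (1 - alpha) * y.
  have yA : 1 - y <= A by rewrite /A; nra.
  have A1 : A <= 1 by rewrite /A; nra.
  pose c := (1 - y) * ((1 - alpha) / (1 + alpha)).
  have c0 : 0 <= c by rewrite mulr_ge0 ?divr_ge0//; lra.
  have cK : c * K = 1 - y by rewrite /c /K; field; apply/andP; split; lra.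
  have hc : c * (alpha + A) <= (1 - alpha) * A.
    have -> : (1 - alpha) * A = A * ((1 - alpha) / (1 + alpha)) * (1 + alpha).
      by field; lra.
    apply: ler_pM => //; [lra| |lra].
    by apply: ler_wpM2r => //; rewrite divr_ge0//; lra.
  have eps2 : 0 <= eps / 2 by lra.
  have y01 : 0 < y < 1 by rewrite y0.
  apply: le_trans (tv_srrw_le W mu_pmf muJ a01 c0 y01 hc eps2 t1 ht m1) _.
  rewrite [leRHS](splitr eps) lerD2l.
  apply: (@le_trans _ _ (expR (- ln (2 / eps)))); last first.
    by rewrite expRN lnK ?posrE ?divr_gt0// invf_div.
  rewrite ler_expR.
  have cm : (1 - y) * (1 + eta) * t%:R <= c * m%:R.
    by have := ler_wpM2l c0 Bm; rewrite /B; rewrite -cK; lra.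
  have rE : (1 - y)^-1 <= 1 + eta / 4.
    rewrite invf_ple ?posrE; [|lra|lra].
    by rewrite -[leLHS]mul1r ler_pdivrMr; nra.
  have Lty : ln (2 / eps) <= t%:R * y * (eta / 2).
    have -> : t%:R * y * (eta / 2) = t%:R * (eta ^+ 2 / (8 * (1 + eta))).
      by rewrite /y; field; lra.
    rewrite -ler_pdivrMr; last by rewrite divr_gt0 ?exprn_gt0//; lra.
    apply: le_trans Lt; rewrite le_eqVlt; apply/orP; left; apply/eqP.
    by field; apply/andP; split; lra.
  have ty0 : 0 <= t%:R * y by rewrite mulr_ge0// ltW.
  have h1 := ler_wpM2l ty0 rE.
  have h2 := ler_wpM2r (ltW y0) cm.
  have h3 : (1 - y) * (1 + eta) = 1 + eta - eta / 4 by rewrite mulrBl yE mul1r.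
  rewrite h3 in h2; lra.
rewrite inver gt_eqF//; apply: (@le_trans _ _ ((B + 1)%:E * (t%:R^-1)%:E)%E).
  by apply: lee_wpmul2r => //; rewrite lee_fin invr_ge0 ltW.
rewrite -EFinM lee_fin mulrDl mul1r /B mulfK ?gt_eqF// lerD2l.
by rewrite invf_ple ?posrE.
Qed.

Lemma limn_esup_tmix_ratio (R : realType) (gT : nat -> finGroupType)
    (mu : forall n, gT n -> R) (alpha : R) (W0 : forall n, SRRW (mu n) 0)
    (W : forall n, SRRW (mu n) alpha) (eps : R) :
  (forall n, (1 <= n)%N -> is_pmf (mu n) /\ class_pmf (mu n)) ->
  (fun n => tmix (W0 n) (eps / 2)) @ \oo --> +oo%E ->
  0 <= alpha < 1 -> 0 < eps < 1 ->
  (limn_esup (fun n => (tmix (W n) eps / tmix (W0 n) (eps / 2))%E)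
     <= ((1 + alpha) / (1 - alpha))%:E)%E.
Proof.
move=> hmu tmix0y a01 eps01; case/andP: (a01) => a0 a1.
set K := (1 + alpha) / (1 - alpha).
have K0 : 0 <= K by rewrite divr_ge0//; lra.
(* eta is chosen such that (1 + eta) * K + eta = K + e. *)
apply/lee_addgt0Pr => e e0; pose eta := e / (K + 1).
have eta0 : 0 < eta by rewrite divr_gt0//; lra.
have -> : (K%:E + e%:E = ((1 + eta) * K + eta)%:E)%E.
  by rewrite -EFinD /eta; congr EFin; field; lra.
have tmix_big := (cvgeyPge _).1 tmix0y
  (ln (2 / eps) * 8 * (1 + eta) / eta ^+ 2 + eta^-1).
apply: limn_esup_le_near; near=> n.
have n1 : (1 <= n)%N by near: n; exact: nbhs_infty_ge.
have [mu_pmf muJ] := hmu n n1.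
by apply: tmix_ratio_le => //; near: n; exact: tmix_big.
Unshelve. all: by end_near. Qed.

Theorem proposition1p7 (R : realType) :
  (forall (gT : finGroupType) (mu : gT -> R) (alpha : R)
      (W0 : SRRW mu 0) (W : SRRW mu alpha),
    (2 <= #|gT|)%N -> is_pmf mu ->
    irreducible_kernel (walk_kernel mu) -> aperiodic_kernel (walk_kernel mu) ->
    0 <= alpha < 1 -> class_pmf mu ->
    forall eps : R, 0 < eps < 1 ->
      (tmix W eps <=
         ((1 - alpha)^-1)%:E *
           maxe (8%:E * tmix W0 (eps / 2)) (18 * ln (4 / eps))%:E + 1%:E)%E)
  /\
  (forall (gT : nat -> finGroupType) (mu : forall n, gT n -> R)
      (W0 : forall n, SRRW (mu n) 0),
    (forall n, (1 <= n)%N ->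
      [/\ (2 <= #|gT n|)%N, is_pmf (mu n),
          irreducible_kernel (walk_kernel (mu n)),
          aperiodic_kernel (walk_kernel (mu n)) & class_pmf (mu n)]) ->
    (forall eps : R, 0 < eps < 1 ->
      (fun n => tmix (W0 n) (eps / 2)) @ \oo --> +oo%E) ->
    forall (alpha : R) (W : forall n, SRRW (mu n) alpha),
      0 <= alpha < 1 ->
      forall eps : R, 0 < eps < 1 ->
        (limn_esup (fun n => (tmix (W n) eps / tmix (W0 n) (eps / 2))%E)
           <= ((1 + alpha) / (1 - alpha))%:E)%E).
Proof.
split=> [gT mu alpha W0 W _ mu_pmf _ _ a01 muJ eps eps01|].
  exact: tmix_srrw_le.
move=> gT mu W0 hmu tmix0y alpha W a01 eps eps01.
apply: limn_esup_tmix_ratio => // [n /hmu[]//|].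
exact: tmix0y.
Qed.
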